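(* Let $\mu\in\mathbb{R}$, $\sigma>0$, $S_0>0$ be constants, let $\tilde\mu=\mu-\sigma^2/2$, and let $S_t=S_0\exp(\tilde\mu t+\sigma B_t)$ for $t\ge0$. Let $k>0$, $\theta>0$, and let $T$ be a random variable independent of $(B_t)_{t\ge0}$ with the inverse gamma distribution $\mathrm{IGamma}(k,\theta)$ with shape parameter $k$ and scale parameter $\theta$. Then the probability density function of $S_T$ is, for $x>0$, $$f_{\mathrm{IGamma}}(x)=\frac{\sqrt{2}\,\theta^k}{\sqrt{\pi}\,\sigma\,\Gamma(k)\,S_0}\left(\frac{x}{S_0}\right)^{\tilde\mu/\sigma^2-1}\left(\frac{(\ln(x/S_0))^2}{\sigma^2}+2\theta\right)^{-(2k+1)/4}\left(\frac{\tilde\mu^2}{\sigma^2}\right)^{(2k+1)/4}K_{k+1/2}\!\left(\sqrt{\left(\frac{(\ln(x/S_0))^2}{\sigma^2}+2\theta\right)\frac{\tilde\mu^2}{\sigma^2}}\right)$$ if $\tilde\mu\neq0$, and $$f_{\mathrm{IGamma}}(x)=\frac{2^k\theta^k\,\Gamma(k+1/2)}{\sqrt{\pi}\,\sigma\,\Gamma(k)}\,\frac{1}{x}\left(\left(\frac{\ln(x/S_0)}{\sigma}\right)^2+2\theta\right)^{-(k+1/2)}$$ if $\tilde\mu=0$.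
   Context: $(B_t)_{t\ge0}$ is a standard one-dimensional Brownian motion with $B_0=0$; $S_t$ is geometric Brownian motion, the It\^o solution of $dS_t=\mu S_t\,dt+\sigma S_t\,dB_t$ started at $S_0$, and $S_T$ is its value at the random time $T$. $K_\nu$ is the modified Bessel function of the second kind and $\Gamma$ the gamma function. $\mathrm{IGamma}(k,\theta)$ is the distribution on $(0,\infty)$ with density $\frac{\theta^k}{\Gamma(k)}\left(\frac1t\right)^{k+1}\exp\left(-\frac{\theta}{t}\right)$. *)

(* Defs.v *)
From HB Require Import structures.
From mathcomp Require Import all_boot all_order all_algebra.
From mathcomp Require Import all_classical all_reals all_analysis.

Set Implicit Arguments.
Unset Strict Implicit.
Unset Printing Implicit Defensive.

Import Order.TTheory GRing.Theory Num.Theory.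
Import numFieldNormedType.Exports.

Local Open Scope classical_set_scope.
Local Open Scope ring_scope.

Section special_functions.
Context {R : realType}.
Implicit Types k theta nu t x : R.

(* Euler's integral; meaningful for 0 < k. *)
Definition Gamma k : R :=
  \int[lebesgue_measure]_(t in `]0, +oo[) (t `^ (k - 1) * expR (- t)).

Definition cosh x : R := (expR x + expR (- x)) / 2.

(* Modified Bessel function of the second kind, of any real order nu, at
   0 < x: K_nu(x) = \int_0^oo exp(- x cosh t) cosh(nu t) dt (DLMF 10.32.9). *)
Definition besselK nu x : R :=
  \int[lebesgue_measure]_(t in `[0, +oo[) (expR (- x * cosh t) * cosh (nu * t)).

Definition igamma_pdf k theta t : R :=
  if 0 < t then
    theta `^ k / Gamma k * (1 / t) `^ (k + 1) * expR (- (theta / t))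
  else 0.

End special_functions.

Section densities.
Context {R : realType}.

Definition is_density (m : set R -> \bar R) (f : R -> R) : Prop :=
  [/\ measurable_fun setT f, (forall x, 0 <= f x) &
      forall A : set R, measurable A ->
        m A = (\int[lebesgue_measure]_(x in A) (f x)%:E)%E].

(* X is only required to be a random variable up to a P-null set: P need not
   be complete, and an evaluation B_T of a process with almost surely
   continuous paths at a random time T that is almost surely positive need not
   be measurable on the exceptional set. For measurable X this is the usual
   notion, see has_pdf_RV below. *)
Definition has_pdf d (Omega : measurableType d) (P : probability Omega R)
    (X : Omega -> R) (f : R -> R) : Prop :=
  exists2 Y : {RV P >-> R},
    {ae P, forall w, X w = Y w} & is_density (distribution P Y) f.

Lemma has_pdf_RV d (Omega : measurableType d) (P : probability Omega R)
    (X : {RV P >-> R}) (f : R -> R) :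
  has_pdf P X f <-> is_density (distribution P X) f.
Proof.
split=> [[Y XY [mf f0 fE]]|fX]; last by exists X => //; apply: aeW.
split=> // A mA; rewrite -fE// /distribution /pushforward.
have mXA : measurable (X @^-1` A) by rewrite -[_ @^-1` _]setTI; exact: measurable_funPT.
have mYA : measurable (Y @^-1` A) by rewrite -[_ @^-1` _]setTI; exact: measurable_funPT.
have [N [mN PN0 sub]] := XY.
have PUN (U : set Omega) : measurable U -> (P (U `|` N) <= P U)%E.
  by move=> mU; rewrite (le_trans (measureU2 _ mU mN))// [X in (_ + X)%E]PN0 adde0.
apply/eqP; rewrite eq_le; apply/andP; split.
- apply: le_trans (PUN _ mYA); apply: le_measure; rewrite ?inE//.
    exact: measurableU.
  move=> w Aw; have [XYw|XYw] := pselect (X w = Y w).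
    by left; rewrite /preimage/= -XYw.
  by right; apply: sub.
- apply: le_trans (PUN _ mXA); apply: le_measure; rewrite ?inE//.
    exact: measurableU.
  move=> w Aw; have [XYw|XYw] := pselect (X w = Y w).
    by left; rewrite /preimage/= XYw.
  by right; apply: sub.
Qed.

End densities.

Section independence.
Context d (Omega : measurableType d) {R : realType} (P : probability Omega R).

(* Taking A i := setT recovers the product rule for subfamilies. *)
Definition mutually_independent n (X : 'I_n -> Omega -> R) : Prop :=
  forall A : 'I_n -> set R, (forall i, measurable (A i)) ->
    P (\bigcap_i (X i @^-1` A i)) = (\prod_(i < n) P (X i @^-1` A i))%E.

(* The sigma-algebra generated by (B_t)_{t >= 0}. *)
Definition process_sigma_algebra (B : R -> Omega -> R) : set (set Omega) :=
  <<s [set E | exists2 t : R, 0 <= t &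
         exists2 A : set R, measurable A & E = B t @^-1` A] >>.

Definition independent_of_process (T : Omega -> R) (B : R -> Omega -> R) :=
  forall (A : set R) (E : set Omega), measurable A ->
    process_sigma_algebra B E ->
    P (T @^-1` A `&` E) = (P (T @^-1` A) * P E)%E.

End independence.

(* B t is only constrained for 0 <= t. The second argument of normal_prob is
   the standard deviation. *)
Definition standard_brownian_motion d (Omega : measurableType d)
    (R : realType) (P : probability Omega R) (B : R -> {RV P >-> R}) : Prop :=
  [/\ {ae P, forall w, B 0 w = 0},
      (forall (n : nat) (t : nat -> R), 0 <= t 0%N ->
         (forall i, t i <= t i.+1) ->
         mutually_independent P
           (fun (i : 'I_n) w => B (t i.+1) w - B (t i) w)),
      (forall s t : R, 0 <= s -> s < t -> forall A : set R, measurable A ->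
         P ((fun w => B t w - B s w) @^-1` A)
         = normal_prob 0 (Num.sqrt (t - s)) A) &
      {ae P, forall w, {within `[0, +oo[, continuous (fun t => B t w)}}].

(* Main.v *)
Require Import Defs.
From HB Require Import structures.
From mathcomp Require Import all_boot all_order all_algebra.
From mathcomp Require Import all_classical all_reals all_analysis.
From mathcomp Require Import measurable_realfun.
From mathcomp Require Import ring.

Set Implicit Arguments.
Unset Strict Implicit.
Unset Printing Implicit Defensive.

Import Order.TTheory GRing.Theory Num.Theory.
Import numFieldNormedType.Exports.

Local Open Scope classical_set_scope.
Local Open Scope ring_scope.

(** Condition on [T]. Given [T = t], the logarithm of [S_T / S0] is normal with
    mean [tmu * t] and variance [sigma ^+ 2 * t], so that [S_T] has at [x] the
    mixed density, the integral over [t] of the lognormal density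
    [gbm_pdf t x] against the inverse gamma density of [T]
    ([gbm_random_time]). Expanding the square
    [(ln (x / S0) - tmu * t) ^+ 2 / (2 * sigma ^+ 2 * t)], the product of the
    two densities is, up to a factor that depends on [x] only, the unnormalised
    generalised inverse Gaussian density
    [t `^ (- nu - 1) * expR (- (a / t + b * t) / 2)] with [nu = k + 1 / 2],
    [a = ln (x / S0) ^+ 2 / sigma ^+ 2 + 2 * theta] and
    [b = tmu ^+ 2 / sigma ^+ 2] ([gbm_igamma_pdfE]). Its total mass is a Bessel
    function if [b] is positive ([integral_gig_bessel]) and a gamma function if
    [b = 0] ([integral_gig_gamma]); these are the two cases of the theorem.

    Two points need care. The first is the conditioning itself: the map
    [w |-> B (T w) w] need not be measurable, and [T] is independent of the
    sigma-algebra generated by [B] only. Path continuity provides a map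
    [eval_process] that is jointly measurable in the time and in the
    sigma-algebra of [B] and agrees with [B t w] on every continuous path.
    Independence says that the law of [w |-> (T w, w)] is a product measure,
    and the conditioning becomes an integration over sections of that product
    ([law_eval_process_time]). The second is finiteness: the mixed density is
    an extended real integral, whereas the densities and special functions of
    the theorem are real. As the mixed density integrates to [1], it is finite
    almost everywhere, so taking [fine] does not change its integrals
    ([is_density_fine]), and [fine] commutes with real factors without any
    condition ([fineZ]). *)

(** * Integration against a measure with a density *)

Section density_measure.
Context d (T : measurableType d) (R : realType).
Variables (m : {measure set T -> \bar R}) (p : T -> R).
Hypotheses (mp : measurable_fun setT p) (p0 : forall x, 0 <= p x).
Local Open Scope ereal_scope.

Let density_set0 : \int[m]_(x in set0) (p x)%:E = 0.
Proof. exact: integral_set0. Qed.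

Let density_ge0 (A : set T) : 0 <= \int[m]_(x in A) (p x)%:E.
Proof. by apply: integral_ge0 => x _; rewrite lee_fin. Qed.

Let density_sigma_additive :
  semi_sigma_additive (fun A => \int[m]_(x in A) (p x)%:E).
Proof.
move=> F mF tF mUF; rewrite ge0_integral_bigcup//.
- by apply: is_cvg_ereal_nneg_natsum_cond => n _ _; exact: density_ge0.
- by apply/(measurable_funS measurableT)/measurable_EFinP.
- by move=> x _; rewrite lee_fin.
Qed.

Lemma density_measure_ex :
  exists nu : {measure set T -> \bar R},
    forall A, nu A = \int[m]_(x in A) (p x)%:E.
Proof.
pose nu : {measure set T -> \bar R} :=
  HB.pack (fun A : set T => \int[m]_(x in A) (p x)%:E)
    (isMeasure.Build _ _ _ _ density_set0 density_ge0 density_sigma_additive).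
by exists nu.
Qed.

Import HBNNSimple.

(** Both sides agree on indicator functions by hypothesis, hence on simple
    functions by linearity, hence in general by monotone convergence. *)
Lemma ge0_integral_density (nu : {measure set T -> \bar R}) (f : T -> \bar R) :
  (forall A, measurable A -> nu A = \int[m]_(x in A) (p x)%:E) ->
  measurable_fun setT f -> (forall x, 0 <= f x) ->
  \int[nu]_x f x = \int[m]_x (f x * (p x)%:E).
Proof.
move=> nuE mf f0.
have mpE : measurable_fun setT (EFin \o p) by exact/measurable_EFinP.
pose g := nnsfun_approx measurableT mf.
have gf x : EFin \o g ^~ x @ \oo --> f x by apply: cvg_nnsfun_approx.
transitivity (limn (fun n => \int[nu]_x (g n x)%:E)).
  rewrite -monotone_convergence//.
  - by apply: eq_integral => x _; apply/esym/cvg_lim => //; exact: gf.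
  - by move=> n; exact/measurable_EFinP.
  - by move=> n x _; rewrite lee_fin.
  - by move=> x _ a b ab; rewrite lee_fin; exact/lefP/nd_nnsfun_approx.
transitivity (limn (fun n => \int[m]_x ((g n x)%:E * (p x)%:E))); last first.
  rewrite -monotone_convergence//.
  - apply: eq_integral => x _; apply/cvg_lim => //.
    by apply: cvgeMr => //; exact: gf.
  - by move=> n; apply: emeasurable_funM => //; exact/measurable_EFinP.
  - by move=> n x _; rewrite mule_ge0 ?lee_fin.
  - move=> x _ a b ab; rewrite lee_wpmul2r ?lee_fin//.
    exact/lefP/nd_nnsfun_approx.
apply/congr_lim/funext => n.
under eq_integral do rewrite fimfunE -fsumEFin//.
rewrite ge0_integral_fsum//; last 2 first.
- by move=> r; exact/measurable_EFinP/measurable_funM.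
- by move=> r x _; rewrite nnfun_muleindic_ge0.
under [RHS]eq_integral => x _.
  rewrite fimfunE -fsumEFin// ge0_mule_fsuml; last first.
    by move=> r; rewrite nnfun_muleindic_ge0.
  over.
rewrite ge0_integral_fsum//; last 2 first.
- move=> r; apply: emeasurable_funM => //.
  exact/measurable_EFinP/measurable_funM.
- by move=> r x _; rewrite mule_ge0 ?nnfun_muleindic_ge0 ?lee_fin.
apply: eq_fsbigr => r /[!inE] -[x _ <-].
set r0 := g n x; have r0_ge0 : (0 <= r0)%R by [].
rewrite integralZl_indic_nnsfun// integral_indic// setIT nuE//.
under [RHS]eq_integral do rewrite EFinM -muleA.
rewrite ge0_integralZl//; last 2 first.
- by apply: emeasurable_funM => //; exact/measurable_EFinP.
- by move=> y _; rewrite mule_ge0 ?lee_fin.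
congr (_ * _); rewrite integral_mkcond; apply: eq_integral => y _.
by rewrite epatch_indic muleC.
Qed.

End density_measure.

(** * Exponential substitution *)

Section log_substitution.
Context {R : realType}.
Notation mu := (@lebesgue_measure R).

(** On the positive half-line inversion coincides with the measurable function
    [powR ^~ (-1)]. *)
Lemma measurable_inv_gt0 : measurable_fun setT
  (fun x : R => \1_(`]0, +oo[%classic : set R) x * x^-1).
Proof.
rewrite (_ : (fun _ => _) = fun x => \1_(`]0, +oo[%classic : set R) x * x `^ (-1)).
  by apply: measurable_funM => //; exact: measurable_powR.
apply/funext => x; rewrite indicE; case: (boolP (x \in _)); last by rewrite !mul0r.
by rewrite inE/= in_itv/= andbT => x0; rewrite powR_inv1// ltW.
Qed.

Lemma integral_inv_itv (c a b : R) : 0 < a -> a < b ->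
  (\int[mu]_(x in `]a, b]) (c * x^-1)%:E = (c * (ln b - ln a))%:E)%E.
Proof.
move=> a0 ab.
have cV x : a <= x -> {for x, continuous (fun x : R => c * x^-1)}.
  move=> ax; apply: cvgM; first exact: cvg_cst.
  by apply: inv_continuous; rewrite gt_eqF// (lt_le_trans a0).
have cw : {within `[a, b], continuous (fun x : R => c * x^-1)}.
  apply: continuous_in_subspaceT => x; rewrite inE/= in_itv/= => /andP[ax _].
  exact: cV.
have dln x : a < x -> is_derive x 1 (c *: @ln R) (c * x^-1).
  move=> ax; have := is_derive1_ln (lt_trans a0 ax) => ?.
  exact: is_deriveZ.
rewrite integral_itv_obnd_cbnd; last first.
  apply/measurable_EFinP; apply: (@measurable_funS _ _ _ _ `[a, b]) => //.
    by apply: subset_itv; rewrite bnd_simp.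
  exact: subspace_continuous_measurable_fun.
rewrite (@continuous_FTC2 _ _ (c *: @ln R))// ?mulrBr ?EFinB//.
- split.
  + by move=> x; rewrite in_itv/= => /andP[ax _]; have [] := dln _ ax.
  + apply/cvg_at_right_filter; apply: cvgZr; exact: continuous_ln.
  + apply/cvg_at_left_filter; apply: cvgZr; apply: continuous_ln; exact: lt_trans ab.
- move=> x; rewrite in_itv/= => /andP[ax _].
  by rewrite derive1E; have [_ ->] := dln _ ax.
Qed.

(** The substitution [x = expR (m + s * u)], which maps the line onto the
    positive half-line, for an integrand that is only measurable. It amounts to
    the fact that the image of the measure of density [(s * x)^-1] on the
    positive half-line under [x |-> (ln x - m) / s] is Lebesgue measure, and by
    uniqueness of the latter this need only be checked on bounded intervals,
    where it is the computation of [integral_inv_itv]. Writing the substitution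
    in this direction keeps those intervals away from [0], so no improper
    integral occurs. *)
Lemma ge0_integral_exp_substitution (m s : R) (h : R -> \bar R) : 0 < s ->
  measurable_fun setT h -> (forall x, (0 <= h x)%E) ->
  (\int[mu]_x h x =
   \int[mu]_(x in `]0%R, +oo[) (h ((ln x - m) / s)%R * ((s * x)^-1)%:E))%E.
Proof.
move=> s0 mh h0.
pose phi0 (x : R) : R := (ln x - m) / s.
have mphi0 : measurable_fun setT phi0.
  by apply: measurable_funM => //; exact: measurable_funB.
pose phi : measurableTypeR R -> measurableTypeR R := phi0.
have mphi : measurable_fun setT phi := mphi0.
pose p (x : R) := s^-1 * (\1_(`]0, +oo[%classic : set R) x * x^-1).
have mp : measurable_fun setT p.
  by apply: measurable_funM => //; exact: measurable_inv_gt0.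
have p0 x : 0 <= p x.
  rewrite /p mulr_ge0 ?invr_ge0 ?(ltW s0)// indicE.
  case: (boolP (x \in _)); last by rewrite mul0r.
  by rewrite inE/= in_itv/= andbT => x0; rewrite mul1r invr_ge0 ltW.
(* The measure of density [(s * x)^-1] on the positive half-line. *)
have [dx_s dx_sE] := density_measure_ex lebesgue_measure mp p0.
have phi_itv (a b x : R) : 0 < x ->
    (a < phi0 x <= b) = (expR (m + s * a) < x <= expR (m + s * b)).
  move=> x0; rewrite /phi0 ltr_pdivlMr// ler_pdivrMr// ltrBrDl lerBlDl.
  rewrite -[in RHS](lnK (x := x)) ?posrE// ltr_expR ler_expR.
  by rewrite ![_ * s]mulrC.
have lebE (A : set R) : measurable A -> mu A = pushforward dx_s phi A.
  move: A; apply/lebesgue_measure_unique => //= _ [[a b]] _ <-.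
  rewrite /pushforward dx_sE lebesgue_measure_itv/= lte_fin.
  transitivity (\int[mu]_(x in `](expR (m + s * a)), (expR (m + s * b))])
     (s^-1 * x^-1)%:E)%E; last first.
    rewrite [LHS]integral_mkcond [RHS]integral_mkcond.
    apply: eq_integral => x _; rewrite !patchE /p indicE.
    have [x0|x0] := ltP 0 x.
      have -> : (x \in phi @^-1` `]a, b]) =
          (x \in `](expR (m + s * a)), (expR (m + s * b))]%classic).
        by apply/idP/idP; rewrite !inE/= !in_itv/= -phi_itv.
      rewrite (mem_set (A := `]0, +oo[%classic)) ?mul1r//=.
      by rewrite in_itv/= andbT.
    rewrite (memNset (A := `]0, +oo[%classic)) ?mul0r ?mulr0 ?if_same//=; last first.
      by rewrite in_itv/= ltNge x0.
    rewrite memNset//= in_itv/= ltNge.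
    by rewrite (le_trans x0) ?expR_ge0.
  have [ab|ba] := ltP a b.
    rewrite integral_inv_itv ?expR_gt0 ?ltr_expR ?ltrD2l ?ltr_pM2l//.
    by rewrite !expRK -EFinB; congr EFin; field; rewrite gt_eqF.
  rewrite set_itv_ge ?integral_set0// bnd_simp -leNgt ler_expR.
  by rewrite lerD2l ler_pM2l.
rewrite (eq_measure_integral (pushforward dx_s phi)) => [|A mA _]; last exact: lebE.
rewrite ge0_integral_pushforward// preimage_setT.
rewrite (@ge0_integral_density _ (measurableTypeR R) _ mu p mp p0 dx_s)//; last 2 first.
- exact (measurableT_comp mh mphi0).
- by move=> x; exact: h0.
rewrite [RHS]integral_mkcond; apply: eq_integral => x _.
rewrite patchE /p indicE; case: ifPn => _; last by rewrite mul0r mulr0 mule0.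
by rewrite mul1r invfM.
Qed.

End log_substitution.

(** * Evaluation of a continuous process at an independent random time *)

Section random_time.
Context {R : realType}.

(** The least multiple of [1 / n.+1] greater than [t], for nonnegative [t]. It
    takes countably many values, which makes [B (grid n t) w] measurable in the
    pair [(t, w)], and it tends to [t] as [n] grows. *)
Definition grid (n : nat) (t : R) : R :=
  (Num.truncn (n.+1%:R * t)).+1%:R / n.+1%:R.

Lemma grid_itv n t : 0 <= t -> t <= grid n t <= t + n.+1%:R^-1.
Proof.
move=> t0; have n0 : 0 < n.+1%:R :> R by [].
have /truncn_itv/andP[lb ub] : 0 <= n.+1%:R * t by rewrite mulr_ge0.
rewrite /grid ler_pdivlMr// ler_pdivrMr// mulrDl mulVf ?gt_eqF//.
by rewrite [t * _]mulrC (ltW ub)/= -natr1 lerD2r.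
Qed.

Lemma cvg_grid t : 0 <= t -> grid n t @[n --> \oo] --> t.
Proof.
move=> t0; apply: (@squeeze_cvgr _ _ _ _ (cst t) (fun n => t + n.+1%:R^-1)).
- by apply: nearW => n; exact: grid_itv.
- exact: cvg_cst.
- rewrite -[X in _ --> X]addr0; apply: cvgD; first exact: cvg_cst.
  exact: cvg_harmonic.
Qed.

Lemma cvg_comp_grid (f : R -> R) t : {within `[0, +oo[, continuous f} ->
  0 <= t -> f (grid n t) @[n --> \oo] --> f t.
Proof.
move=> /subspace_continuousP cf t0.
apply: (cvg_comp (fun n => grid n t) f); last first.
  by apply: cf; rewrite /= in_itv/= andbT.
move=> U; rewrite /within/= => /(cvg_grid t0) UP.
near=> n.
have : grid n t \in `[0, +oo[ -> U (grid n t) by near: n; exact: UP.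
apply; rewrite in_itv/= andbT.
by have /andP[+ _] := grid_itv n t0; exact: le_trans.
Unshelve. all: by end_near. Qed.

End random_time.

Lemma ae_eq_measure d (T : measurableType d) (R : realType)
    (m : {measure set T -> \bar R}) (A A' : set T) :
  measurable A -> measurable A' -> {ae m, forall w, A w <-> A' w} ->
  m A = m A'.
Proof.
move=> mA mA' AA'; rewrite -[A]setIT -[A']setIT -!integral_indic//.
apply: ge0_ae_eq_integral => //.
1-2: exact/measurable_EFinP/measurable_indic.
move: AA'; apply: filterS => w [AA' A'A] _; rewrite !indicE; congr (_%:R%:E).
  by congr nat_of_bool; apply/idP/idP; rewrite !inE.
Qed.

Section evaluation.
Context {R : realType} d (Omega : measurableType d) (P : probability Omega R).
Variable B : R -> {RV P >-> R}.

Let G : set (set Omega) := [set E | exists2 t : R, 0 <= t &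
  exists2 A : set R, measurable A & E = B t @^-1` A].
(* [Omega] with the sigma-algebra generated by the process. *)
Let Omega_B := g_sigma_algebraType G.

(** An upper limit, because it is measurable on the whole space, without
    restriction to the set of continuous paths: that set need not belong to the
    sigma-algebra generated by [B]. *)
Definition eval_process (z : R * Omega) : R :=
  fine (limn_esup (fun n => (B (grid n z.1) z.2)%:E)).

(** Each approximant is measurable, as the preimage of a set is the countable
    union over the values of [grid] of measurable rectangles. *)
Lemma measurable_eval_process :
  measurable_fun setT (eval_process : R * Omega_B -> R).
Proof.
apply: measurableT_comp => //.
apply: measurable_fun_limn_esup => n.
apply/measurable_EFinP => _ A mA; rewrite setTI.
rewrite (_ : _ @^-1` A = \bigcup_j
  ((fun t : R => Num.truncn (n.+1%:R * t)) @^-1` [set j] `*`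
   (B (j.+1%:R / n.+1%:R) @^-1` A : set Omega_B))); last first.
  apply/seteqP; split => [[t w] /= Aw|[t w] [j _ [/= <-]]//].
  by exists (Num.truncn (n.+1%:R * t)).
apply: bigcup_measurable => j _; apply: measurableX.
  (* Monotonicity gives measurability of [truncn], read as a real function. *)
  have mtr : measurable_fun setT (fun t : R => (Num.truncn (n.+1%:R * t))%:R : R).
    apply: nondecreasing_measurable => // x y xy; rewrite ler_nat.
    by apply: le_truncn; rewrite ler_pM2l.
  rewrite (_ : _ @^-1` _ =
    (fun t : R => (Num.truncn (n.+1%:R * t))%:R : R) @^-1` [set j%:R]).
    by rewrite -[X in measurable X]setTI; exact: mtr.
  by apply/seteqP; split => t /= [/eqP]; [move=> /eqP ->|rewrite eqr_nat => /eqP].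
apply: sub_sigma_algebra; exists (j.+1%:R / n.+1%:R) => //.
by exists A.
Qed.

Lemma eval_processE w t : {within `[0, +oo[, continuous (fun t => B t w)} ->
  0 <= t -> eval_process (t, w) = B t w.
Proof.
move=> cB t0; rewrite /eval_process/=.
have /cvg_limn_einf_sup[_ ->] //:
  (fun n => (B (grid n t) w)%:E) @ \oo --> (B t w)%:E.
by apply: cvg_EFin; [exact: nearW|exact: (cvg_comp_grid cB)].
Qed.

Lemma sub_measurable_process (E : set Omega) : <<s G >> E -> measurable E.
Proof.
apply: smallest_sub; first exact: sigma_algebra_measurable.
by move=> _ [t _ [A mA ->]]; exact: measurable_funPTI.
Qed.

Variable T : {RV P >-> R}.
Hypothesis TB : independent_of_process P T (fun t w => B t w).
Hypothesis cB : {ae P, forall w, {within `[0, +oo[, continuous (fun t => B t w)}}.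
Hypothesis T0 : {ae P, forall w, 0 < T w}.

Let pathB : Omega -> R * Omega_B := fun w => (T w, w).

Let measurable_id_process : measurable_fun setT (id : Omega -> Omega_B).
Proof.
by move=> _ A mA; rewrite setTI preimage_id; exact: sub_measurable_process.
Qed.

Let measurable_pathB : measurable_fun setT pathB.
Proof. exact: measurable_fun_pair. Qed.

Lemma measurable_eval_process_time :
  measurable_fun setT (fun w => eval_process (T w, w)).
Proof.
exact: (measurableT_comp measurable_eval_process measurable_pathB).
Qed.

Lemma ae_eval_process_time : {ae P, forall w, eval_process (T w, w) = B (T w) w}.
Proof.
by move: cB T0; apply: filterS2 => w cBw /ltW T0w; exact: eval_processE.
Qed.

(** Conditioning on [T]. By independence the law of [w |-> (T w, w)], taken on
    [R * Omega_B], is the product of its marginals, and the measure of a set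
    for the product is the integral of the measures of its sections. The
    section at [t] is the event that concerns [eval_process B (t, w)], which is
    [B t w] for almost every [w]. *)
Lemma law_eval_process_time (C : set (R * R)) : measurable C ->
  P [set w | C (T w, eval_process (T w, w))] =
  (\int[distribution P T]_(t in `]0%R, +oo[) P [set w | C (t, B t w)])%E.
Proof.
move=> mC.
pose idB : {mfun Omega >-> Omega_B} :=
  HB.pack (id : Omega -> Omega_B)
    (isMeasurableFun.Build _ _ _ _ (id : Omega -> Omega_B) measurable_id_process).
pose pB : {mfun Omega >-> (R * Omega_B)%type} :=
  HB.pack pathB (isMeasurableFun.Build _ _ _ _ pathB measurable_pathB).
pose PB : probability Omega_B R := distribution P idB.
pose X : set (R * Omega_B) := [set z | C (z.1, eval_process z)].
have mX : measurable X.
  rewrite -[X]setTI.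
  apply: (measurable_fun_pair measurable_fst measurable_eval_process) => //.
transitivity ((distribution P T \x PB)%E X).
  rewrite (@product_measure_unique _ _ _ _ _ (distribution P T) PB (distribution P pB))//.
rewrite /product_measure1/=.
have mXt t : measurable [set w | C (t, B t w)].
  rewrite -[X in measurable X]setTI.
  by apply: (measurable_fun_pair (f := cst t) (g := B t)) => //; exact: measurable_cst.
have T0N : distribution P T `]-oo, 0] = 0%E.
  rewrite -[RHS](measure0 P); apply: (@ae_eq_measure _ _ _ P (T @^-1` `]-oo, 0])) => //.
    by rewrite -[X in measurable X]setTI; exact: measurable_funPT.
  by apply: filterS T0 => w Tw; split => //=; rewrite in_itv/= leNgt Tw.
rewrite (ge0_negligible_integral _ _ _ _ T0N)//; last first.
  exact: measurable_fun_xsection.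
rewrite setTD setCitvl; apply: eq_integral => t; rewrite inE/= in_itv/= andbT => t0.
have XtE : xsection X t = [set w | C (t, eval_process (t, w))].
  by apply/seteqP; split => w; rewrite /xsection/= inE.
have mXt' : measurable [set w | C (t, eval_process (t, w))].
  by apply: sub_measurable_process; rewrite -XtE; have := measurable_xsection t mX; exact.
rewrite -[LHS]/(P (xsection X t)) XtE.
apply: ae_eq_measure => //.
by apply: filterS cB => w cBw /=; rewrite eval_processE// ltW.
Qed.

End evaluation.

(** * Mass of the generalised inverse Gaussian density *)

Section generalized_inverse_gaussian.
Context {R : realType}.
Notation mu := (@lebesgue_measure R).
Implicit Types (nu a b m t u : R).

(** The unnormalised density of the generalised inverse Gaussian law. *)
Definition gig nu a b t : R := t `^ (- nu - 1) * expR (- (a / t + b * t) / 2).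

Lemma gig_ge0 nu a b t : 0 <= gig nu a b t.
Proof. by rewrite mulr_ge0 ?powR_ge0 ?expR_ge0. Qed.

Lemma ge0_integralN (h : R -> \bar R) :
  measurable_fun setT h -> (forall x, (0 <= h x)%E) ->
  (\int[mu]_x h (- x)%R = \int[mu]_x h x)%E.
Proof.
move=> mh h0; pose opp : measurableTypeR R -> measurableTypeR R := -%R.
have mopp : measurable_fun setT opp by exact: oppr_measurable.
transitivity (\int[mu]_(x in opp @^-1` setT) (h \o opp) x)%E => //.
rewrite -(ge0_integral_pushforward mopp)//.
by apply: eq_measure_integral => // A mA _; exact: lebesgue_measureN.
Qed.

(** The integrand of [gig] after the substitution [t = expR v]. *)
Definition gig_exp nu a b v : R :=
  expR (- nu * v) * expR (- (a * expR (- v) + b * expR v) / 2).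

Lemma gig_exp_ge0 nu a b v : 0 <= gig_exp nu a b v.
Proof. by rewrite mulr_ge0 ?expR_ge0. Qed.

Lemma measurable_gig_exp nu a b : measurable_fun setT (gig_exp nu a b).
Proof.
apply: measurable_funM.
  by apply: measurableT_comp => //; exact: measurable_funM.
apply: measurableT_comp => //; apply: measurable_funM => //.
apply: measurableT_comp => //; apply: measurable_funD => //.
  by apply: measurable_funM => //; exact: measurableT_comp.
exact: measurable_funM.
Qed.

Lemma measurable_gig_expE nu a b m :
  measurable_fun setT (fun u => (gig_exp nu a b (m + u))%:E).
Proof.
apply/measurable_EFinP; apply: (measurableT_comp (measurable_gig_exp nu a b)).
exact: measurable_funD.
Qed.

Lemma integral_gig_exp nu a b m :
  (\int[mu]_(t in `]0%R, +oo[) (gig nu a b t)%:E =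
   \int[mu]_u (gig_exp nu a b (m + u))%:E)%E.
Proof.
rewrite (ge0_integral_exp_substitution m (ltr01 : 0 < 1)); last 2 first.
- exact: measurable_gig_expE.
- by move=> u; rewrite lee_fin gig_exp_ge0.
apply: eq_integral => t; rewrite inE/= in_itv/= andbT => t0.
rewrite -EFinM divr1 mul1r subrKC /gig_exp expRN !lnK ?posrE//; congr EFin.
rewrite /gig mulrAC; congr (_ * _).
rewrite powRD; last by apply/implyP => _; rewrite gt_eqF.
by rewrite powR_inv1 ?ltW// [- nu * _]mulrC expRM lnK.
Qed.

Lemma cosh_ge0 u : 0 <= cosh u.
Proof. by rewrite divr_ge0 ?addr_ge0 ?expR_ge0. Qed.

(** With [m] chosen so that [a * expR (- m) = b * expR m], the substitution
    [t = expR (m + u)] turns [(a / t + b * t) / 2] into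
    [Num.sqrt (a * b) * cosh u]; adding the contributions of [u] and [- u]
    produces the factor [2 * cosh (nu * u)]. *)
Lemma integral_gig_bessel nu a b : 0 < a -> 0 < b ->
  (\int[mu]_(t in `]0%R, +oo[) (gig nu a b t)%:E =
   (2 * (b / a) `^ (nu / 2))%:E * \int[mu]_(u in `[0%R, +oo[)
      (expR (- Num.sqrt (a * b) * cosh u) * cosh (nu * u))%:E)%E.
Proof.
move=> a0 b0; have ab0 : 0 < a / b by rewrite divr_gt0.
pose m := ln (a / b) / 2; pose z := Num.sqrt (a * b).
have em2 : expR m ^+ 2 = a / b.
  by rewrite -expRM_natl /m mulrC divfK// lnK.
have sqrtE (x : R) : 0 <= x -> x ^+ 2 = a * b -> x = z.
  by move=> x0 x2; rewrite /z -x2 sqrtr_sqr ger0_norm.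
have bem : b * expR m = z.
  apply: sqrtE; first by rewrite mulr_ge0 ?expR_ge0 ?ltW.
  by rewrite exprMn em2; field; rewrite gt_eqF.
have aem : a * expR (- m) = z.
  apply: sqrtE; first by rewrite mulr_ge0 ?expR_ge0 ?ltW.
  by rewrite exprMn expRN exprVn em2; field; rewrite !gt_eqF.
pose h u := expR (- nu * u) * expR (- z * cosh u).
have mcosh : measurable_fun setT (@cosh R).
  apply: measurable_funM => //; apply: measurable_funD => //.
  exact: measurableT_comp.
have mh : measurable_fun setT h.
  apply: measurable_funM; apply: measurableT_comp => //.
  exact: measurable_funM.
have h0 u : 0 <= h u by rewrite mulr_ge0 ?expR_ge0.
rewrite (integral_gig_exp _ _ _ m).
transitivity (((b / a) `^ (nu / 2))%:E * \int[mu]_u (h u)%:E)%E.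
  rewrite -ge0_integralZl//=; last 3 first.
  - exact/measurable_EFinP.
  - by move=> u _; rewrite lee_fin.
  - by rewrite lee_fin powR_ge0.
  apply: eq_integral => u _; rewrite -EFinM /gig_exp /h mulrA; congr (_ * expR _)%:E.
    rewrite mulrDr expRD; congr (_ * _).
    rewrite /m [- nu * _]mulrC -mulrA expRM lnK ?posrE//.
    have -> : b / a = (a / b) `^ (-1) by rewrite powR_inv1 ?invf_div// ltW.
    by rewrite -powRrM; congr powR; ring.
  by rewrite [- (m + u)]opprD !expRD !mulrA aem bem /cosh; field.
rewrite [2 * _]mulrC EFinM -muleA; congr (_ * _)%E.
rewrite -ge0_integralZl//=; last 2 first.
- apply/measurable_EFinP; apply: measurable_funTS; apply: measurable_funM.
    apply: measurableT_comp => //; exact: measurable_funM.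
  by apply: measurableT_comp => //; exact: measurable_funM.
- by move=> u _; rewrite lee_fin mulr_ge0 ?expR_ge0// cosh_ge0.
have mhE (D : set R) : measurable_fun D (EFin \o h).
  by apply/measurable_EFinP; exact: measurable_funTS.
have mhN (D : set R) : measurable_fun D (fun u => (h (- u))%:E).
  by apply/measurable_EFinP; apply: measurable_funTS; exact: measurableT_comp.
have -> : [set: R] = `]-oo, 0[ `|` `[0, +oo[.
  by rewrite -setCitvl setUv.
rewrite ge0_integral_setU//; last 3 first.
- exact: mhE.
- by move=> x _; rewrite lee_fin.
- by apply/disj_set2P; rewrite -setCitvl setICr.
rewrite integral_itv_bndo_bndc//.
(* Fold the negative half-line onto the positive one. *)
have hN : (\int[mu]_(u in `]-oo, 0%R]) (h u)%:E =
           \int[mu]_(u in `[0%R, +oo[) (h (- u))%:E)%E.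
  have := @ge0_integration_by_substitution0 R (fun u => (h (- u))%:E) (mhN setT).
  move=> ->; last by move=> u; rewrite lee_fin.
  by apply: eq_integral => u _; rewrite opprK.
have hE0 (D : set R) x : D x -> (0%R <= (h x)%:E)%E by rewrite lee_fin.
have hN0 (D : set R) x : D x -> (0%R <= (h (- x))%:E)%E by rewrite lee_fin.
rewrite hN -(ge0_integralD mu (measurable_itv `[0%R, +oo[)
  (hN0 _) (mhN _) (hE0 _) (mhE _)).
apply: eq_integral => u _; rewrite -EFinD -EFinM /h /cosh; congr EFin.
by rewrite opprK [expR u + _]addrC mulrN mulNr opprK; field.
Qed.

(** The gamma integrand is [gig (- nu) 0 2]. After the exponential
    substitution, the reflection [u |-> - u] exchanges the roles of [a] and [b]
    and changes the sign of [nu], and the shift [m = ln (a / 2)] brings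
    [a / t / 2] to the form [expR (- u)]. *)
Lemma integral_gig_gamma nu a : 0 < a ->
  (\int[mu]_(t in `]0%R, +oo[) (gig nu a 0 t)%:E =
   ((a / 2) `^ (- nu))%:E *
     \int[mu]_(t in `]0%R, +oo[) (t `^ (nu - 1) * expR (- t))%:E)%E.
Proof.
move=> a0; have a20 : 0 < a / 2 by rewrite divr_gt0.
transitivity (((a / 2) `^ (- nu))%:E *
    \int[mu]_(t in `]0%R, +oo[) (gig (- nu) 0 2 t)%:E)%E; last first.
  congr (_ * _)%E; apply: eq_integral => t _.
  rewrite /gig opprK mul0r add0r mulNr; congr (_ * expR (- _))%:E.
  by field.
rewrite (integral_gig_exp _ _ _ (ln (a / 2))) (integral_gig_exp _ _ _ 0).
have mg := measurable_gig_expE (- nu) 0 2 0.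
have g0 u : (0%R <= (gig_exp (- nu) 0 2 (0 + u))%:E)%E by rewrite lee_fin gig_exp_ge0.
rewrite -(ge0_integralN mg g0).
rewrite -ge0_integralZl//; last 2 first.
- exact: (measurableT_comp mg).
- by rewrite lee_fin powR_ge0.
apply: eq_integral => u _; rewrite -EFinM /gig_exp; congr EFin.
rewrite mulrA; congr (_ * expR (- _ / 2)).
  rewrite mulrDr expRD [- nu * ln _]mulrC expRM lnK ?posrE//.
  by congr (_ * expR _); ring.
rewrite !mul0r addr0 !add0r [- (ln _ + _)]opprD expRD !expRN lnK ?posrE//.
by field; rewrite !gt_eqF ?expR_gt0.
Qed.

End generalized_inverse_gaussian.

(** * Real densities from extended real ones *)

Section mixtures.
Context {R : realType}.
Notation mu := (@lebesgue_measure R).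

(** The value at [x] of the inverse is recovered from its restriction [g] to
    the positive half-line as [g x - g (- x)]. *)
Lemma measurable_invr : measurable_fun setT (fun x : R => x^-1).
Proof.
pose g (x : R) := \1_(`]0, +oo[%classic : set R) x * x^-1.
have mg : measurable_fun setT g := measurable_inv_gt0.
rewrite (_ : (fun _ => _) = fun x => g x - g (- x)).
  by apply: measurable_funB => //; exact: measurableT_comp.
apply/funext => x; rewrite /g !indicE !mem_setE !in_itv/= !andbT oppr_gt0.
by case: ltgtP => [x0|x0|<-]; rewrite ?mul0r ?mul1r ?invr0 ?subrr ?subr0 ?sub0r ?invrN ?opprK.
Qed.

(** If [y] is infinite both sides vanish, since the product is then infinite
    or zero. *)
Lemma fineZ (r : R) (y : \bar R) : fine (r%:E * y) = r * fine y.
Proof.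
case: y => [y| |]; first by rewrite -EFinM.
- rewrite mulry /= mulr0; case: sgrP => _.
  + by rewrite mul0e.
  + by rewrite mul1e.
  + by rewrite mulN1e.
- rewrite mulrNy /= mulr0; case: sgrP => _.
  + by rewrite mul0e.
  + by rewrite mul1e.
  + by rewrite mulN1e.
Qed.

(** [F] is integrable, as [m] has mass [1], hence finite almost everywhere. *)
Lemma is_density_fine (m : probability R R) (F : R -> \bar R) :
  measurable_fun setT F -> (forall x, (0 <= F x)%E) ->
  (forall A, measurable A -> m A = (\int[mu]_(x in A) F x)%E) ->
  is_density m (fine \o F).
Proof.
move=> mF F0 mE; split.
- exact: measurableT_comp.
- by move=> x; rewrite fine_ge0.
move=> A mA; rewrite mE//; apply: ge0_ae_eq_integral => //.
- exact: measurable_funTS.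
- by apply/measurable_EFinP; apply: measurable_funTS; exact: measurableT_comp.
- by move=> x _; rewrite lee_fin fine_ge0.
have intF : mu.-integrable setT F.
  apply/integrableP; split => //.
  under eq_integral do rewrite gee0_abs//.
  by rewrite -mE// probability_setT ltry.
apply: filterS (integrable_ae measurableT intF) => x /(_ I) Fx _ /=.
by rewrite fineK.
Qed.

(** The distribution of [X] and Lebesgue measure are measures on [R] for two
    copies of the Borel structure, which differ by their display; [X] is viewed
    with values in the copy that carries Lebesgue measure. *)
Lemma ge0_expectation_density d (Omega : measurableType d)
    (P : probability Omega R) (X : {RV P >-> R}) (p : R -> R) (f : R -> \bar R) :
  is_density (distribution P X) p ->
  measurable_fun setT f -> (forall x, (0 <= f x)%E) ->
  (\int[distribution P X]_x f x = \int[mu]_x (f x * (p x)%:E))%E.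
Proof.
move=> [mp p0 pE] mf f0.
pose X' : {mfun Omega >-> measurableTypeR R} :=
  HB.pack (X : Omega -> measurableTypeR R)
    (isMeasurableFun.Build _ _ _ (measurableTypeR R) (X : Omega -> measurableTypeR R)
       (measurable_funPT X : measurable_fun setT (X : Omega -> measurableTypeR R))).
rewrite ge0_integral_distribution//.
transitivity (\int[distribution P X']_x f x)%E.
  by rewrite ge0_integral_distribution.
by rewrite (@ge0_integral_density _ (measurableTypeR R) _ mu p mp p0 (distribution P X')).
Qed.

End mixtures.

(** * Geometric Brownian motion at an independent random time *)

Section geometric_brownian_motion.
Context {R : realType}.
Notation mu := (@lebesgue_measure R).
Variables (tmu sigma S0 : R).
Hypotheses (sigma0 : 0 < sigma) (S00 : 0 < S0).

(** The lognormal density of [S0 * expR (tmu * t + sigma * Z)] at [x], for [Z]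
    normal of variance [t]. It is set to [0] outside the quadrant of positive
    [t] and [x], so as to be jointly measurable and nonnegative everywhere. *)
Definition gbm_pdf (t x : R) : R :=
  if (0 < t) && (0 < x) then
    (Num.sqrt (2 * pi) * sigma)^-1 * t `^ (- 2^-1) * x^-1
    * expR (- ((ln (x / S0) - tmu * t) ^+ 2 / (2 * sigma ^+ 2 * t)))
  else 0.

Lemma gbm_pdf_ge0 t x : 0 <= gbm_pdf t x.
Proof.
rewrite /gbm_pdf; case: ifPn => // /andP[t0 x0].
by rewrite !mulr_ge0 ?expR_ge0 ?powR_ge0// invr_ge0 ?mulr_ge0 ?sqrtr_ge0// ltW.
Qed.

Lemma measurable_gbm_pdf :
  measurable_fun setT (fun z : R * R => gbm_pdf z.1 z.2).
Proof.
have mV (f : R * R -> R) : measurable_fun setT f ->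
    measurable_fun setT (fun z => (f z)^-1).
  by move=> mf; apply: (measurableT_comp (@measurable_invr R)).
apply: measurable_fun_ifT => //.
  by apply: measurable_and; apply: measurable_fun_ltr.
apply: measurable_funM.
  apply: measurable_funM; last exact: mV.
  apply: measurable_funM => //.
  exact: (measurableT_comp (@measurable_powR R _)).
apply: measurableT_comp => //; apply: measurableT_comp => //.
apply: measurable_funM.
  apply: measurable_funX; apply: measurable_funB; last exact: measurable_funM.
  by apply: (measurableT_comp (@measurable_ln R)); exact: measurable_funM.
by apply: mV; exact: measurable_funM.
Qed.

(** The form in which the density arises from that of [Z] by the substitution
    [x = expR (ln S0 + tmu * t + sigma * z)]. *)
Lemma gbm_pdfE t x : 0 < t -> 0 < x ->
  gbm_pdf t x = normal_pdf 0 (Num.sqrt t) ((ln x - (ln S0 + tmu * t)) / sigma)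
                / (sigma * x).
Proof.
move=> t0 x0; rewrite /gbm_pdf t0 x0/= normal_pdfE ?gt_eqF ?sqrtr_gt0//.
rewrite /normal_peak /normal_fun subr0 sqr_sqrtr ?ltW//.
rewrite ln_div ?posrE// opprD addrA.
rewrite [RHS]mulrAC; congr (_ * expR _).
  have -> : t * pi *+ 2 = 2 * pi * t by ring.
  rewrite [in RHS]sqrtrM ?mulr_ge0 ?pi_ge0// powRN powR12_sqrt ?ltW//.
  by rewrite !invfM; ring.
by field; rewrite !gt_eqF.
Qed.

Context d (Omega : measurableType d) (P : probability Omega R).
Variable B : R -> {RV P >-> R}.
Hypothesis BM : standard_brownian_motion B.

Lemma brownian_marginal t (A : set R) : 0 < t -> measurable A ->
  P (B t @^-1` A) = normal_prob 0 (Num.sqrt t) A.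
Proof.
move=> t0 mA; have [B00 _ BN _] := BM.
have := BN 0 t (lexx _) t0 A mA; rewrite subr0 => <-.
have mBB : measurable_fun setT (fun w => B t w - B 0 w) by exact: measurable_funB.
apply: ae_eq_measure.
- by rewrite -[X in measurable X]setTI; exact: measurable_funPT.
- by rewrite -[X in measurable X]setTI; exact: mBB.
- by apply: filterS B00 => w /= ->; rewrite subr0.
Qed.

Lemma gbm_marginal t (A : set R) : 0 < t -> measurable A ->
  P [set w | A (S0 * expR (tmu * t + sigma * B t w))] =
  (\int[mu]_(x in A) (gbm_pdf t x)%:E)%E.
Proof.
move=> t0 mA.
pose D : set R := (fun z : R => S0 * expR (tmu * t + sigma * z)) @^-1` A.
have mS : measurable_fun setT (fun z : R => S0 * expR (tmu * t + sigma * z)).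
  apply: measurable_funM => //; apply: measurableT_comp => //.
  by apply: measurable_funD => //; exact: measurable_funM.
have mD : measurable D by rewrite -[D]setTI; exact: mS.
rewrite -[LHS]/(P (B t @^-1` D)) brownian_marginal// /normal_prob.
rewrite integral_mkcond (ge0_integral_exp_substitution (ln S0 + tmu * t) sigma0);
  last 2 first.
- apply/(measurable_restrictT (fun z => (normal_pdf 0 (Num.sqrt t) z)%:E)) => //.
  apply: measurable_funTS; apply/measurable_EFinP.
  exact: measurable_normal_pdf.
- by move=> z; apply: erestrict_ge0 => ? _; rewrite lee_fin normal_pdf_ge0.
rewrite [LHS]integral_mkcond [RHS]integral_mkcond; apply: eq_integral => x _.
rewrite !patchE mem_setE/= in_itv/= andbT.
have [x0|x0] := ltP 0 x; last by rewrite /gbm_pdf [0 < x]ltNge x0 andbF if_same.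
have xE : S0 * expR (tmu * t +
    sigma * ((ln x - (ln S0 + tmu * t)) / sigma)) = x.
  rewrite [sigma * _]mulrC divfK ?gt_eqF//.
  have -> : tmu * t + (ln x - (ln S0 + tmu * t)) = ln x - ln S0 by ring.
  by rewrite expRD expRN !lnK ?posrE//; field; rewrite gt_eqF.
have -> : ((ln x - (ln S0 + tmu * t)) / sigma \in D) = (x \in A).
  by apply/idP/idP; rewrite !inE /D/= xE.
by case: ifPn => _; rewrite ?mul0e// -EFinM gbm_pdfE.
Qed.

Variables (T : {RV P >-> R}) (p : R -> R).
Hypothesis TB : independent_of_process P T (fun t w => B t w).
Hypothesis Tp : is_density (distribution P T) p.
Hypothesis p_le0 : forall t, t <= 0 -> p t = 0.

Definition gbm_mixture (x : R) : \bar R := \int[mu]_t (gbm_pdf t x * p t)%:E.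

Lemma ae_time_gt0 : {ae P, forall w, 0 < T w}.
Proof.
have [mp p0 pE] := Tp.
exists (T @^-1` `]-oo, 0]); split.
- by rewrite -[X in measurable X]setTI; exact: measurable_funPT.
- rewrite -[LHS]/(distribution P T `]-oo, 0]) pE//; apply: integral0_eq => t.
  by rewrite /= in_itv/= => /p_le0 ->.
- by move=> w /= /negP; rewrite -leNgt in_itv.
Qed.

(** Tonelli's theorem exchanges the integral over the time, from the
    conditioning on [T], with the one over the value, from the marginal law at
    a fixed time. *)
Lemma gbm_random_time :
  has_pdf P (fun w => S0 * expR (tmu * T w + sigma * B (T w) w))
    (fine \o gbm_mixture).
Proof.
have [mp p0 pE] := Tp; have [_ _ _ cB] := BM.
have mS : measurable_fun setT
    (fun z : R * R => S0 * expR (tmu * z.1 + sigma * z.2)).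
  apply: measurable_funM => //; apply: measurableT_comp => //.
  by apply: measurable_funD => //; exact: measurable_funM.
pose Y0 w := S0 * expR (tmu * T w + sigma * eval_process B (T w, w)).
have mY0 : measurable_fun setT Y0.
  apply: (measurableT_comp mS (g := fun w => (T w, eval_process B (T w, w)))).
  by apply: measurable_fun_pair => //; exact: measurable_eval_process_time.
pose Y : {RV P >-> R} := HB.pack Y0 (isMeasurableFun.Build _ _ _ _ Y0 mY0).
exists Y.
  by apply: filterS (ae_eval_process_time cB ae_time_gt0) => w /= <-.
pose q (z : R * R) : \bar R := (gbm_pdf z.1 z.2 * p z.1)%:E.
have mq : measurable_fun setT q.
  apply/measurable_EFinP; apply: measurable_funM; first exact: measurable_gbm_pdf.
  exact: measurableT_comp.
have q0 z : (0 <= q z)%E by rewrite lee_fin mulr_ge0 ?gbm_pdf_ge0.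
apply: is_density_fine.
- exact: (@measurable_fun_fubini_tonelli_G _ _ _ _ _ mu q mq q0).
- by move=> x; apply: integral_ge0 => t _; exact: (q0 (t, x)).
move=> A mA.
pose C : set (R * R) := [set z | A (S0 * expR (tmu * z.1 + sigma * z.2))].
have mC : measurable C by rewrite -[C]setTI; exact: mS.
rewrite -[LHS]/(P [set w | C (T w, eval_process B (T w, w))]).
rewrite (law_eval_process_time TB cB ae_time_gt0 mC).
pose qA (z : R * R) : \bar R := (gbm_pdf z.1 z.2 * \1_A z.2)%:E.
have mqA : measurable_fun setT qA.
  apply/measurable_EFinP; apply: measurable_funM; first exact: measurable_gbm_pdf.
  by apply: measurableT_comp => //; exact: measurable_indic.
have qA0 z : (0 <= qA z)%E by rewrite lee_fin mulr_ge0 ?gbm_pdf_ge0.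
transitivity (\int[distribution P T]_t \int[mu]_x qA (t, x))%E.
  rewrite integral_mkcond; apply: eq_integral => t _.
  rewrite patchE mem_setE/= in_itv/= andbT; have [t0|t0] := ltP 0 t.
    rewrite gbm_marginal// integral_mkcond; apply: eq_integral => x _.
    by rewrite patchE /qA indicE; case: ifPn; rewrite ?mulr1 ?mulr0.
  by rewrite integral0_eq// => x _; rewrite /qA /gbm_pdf ltNge t0 mul0r.
rewrite (ge0_expectation_density Tp); last 2 first.
- exact: (@measurable_fun_fubini_tonelli_F _ _ _ _ _ mu qA mqA qA0).
- by move=> t; apply: integral_ge0 => x _; exact: (qA0 (t, x)).
pose qAp (z : R * R) : \bar R := (gbm_pdf z.1 z.2 * \1_A z.2 * p z.1)%:E.
have mqAp : measurable_fun setT qAp.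
  apply/measurable_EFinP; apply: measurable_funM; first exact/measurable_EFinP.
  exact: measurableT_comp.
have qAp0 z : (0 <= qAp z)%E by rewrite lee_fin !mulr_ge0 ?gbm_pdf_ge0.
transitivity (\int[mu]_t \int[mu]_x qAp (t, x))%E.
  apply: eq_integral => t _; rewrite -ge0_integralZr//; last 2 first.
  - exact: (measurableT_comp mqA).
  - by rewrite lee_fin.
transitivity (\int[mu]_x \int[mu]_t qAp (t, x))%E.
  exact: (@fubini_tonelli _ _ _ _ _ mu mu qAp mqAp qAp0).
rewrite [RHS]integral_mkcond; apply: eq_integral => x _.
rewrite patchE; case: ifPn => xA.
  by apply: eq_integral => t _; rewrite /qAp/= indicE xA mulr1.
by apply: integral0_eq => t _; rewrite /qAp/= indicE (negbTE xA) mulr0 mul0r.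
Qed.

End geometric_brownian_motion.

(** * The inverse gamma time *)

Lemma measurable_gig (R : realType) (nu a b : R) :
  measurable_fun setT (gig nu a b).
Proof.
apply: measurable_funM; first exact: measurable_powR.
apply: measurableT_comp => //; apply: measurable_funM => //.
apply: measurableT_comp => //; apply: measurable_funD; last exact: measurable_funM.
by apply: measurable_funM => //; exact: measurable_invr.
Qed.

Section inverse_gamma_time.
Context {R : realType}.
Notation mu := (@lebesgue_measure R).
Variables (tmu sigma S0 k theta : R).
Hypotheses (sigma0 : 0 < sigma) (S00 : 0 < S0) (theta0 : 0 < theta).

(** In the expanded square of the exponent of [gbm_pdf] the cross term is
    independent of [t] and yields the power of [x / S0], the term in [1 / t]
    joins the exponent [- (theta / t)] of the inverse gamma density, and the
    term in [t] is the one with coefficient [tmu ^+ 2 / sigma ^+ 2]. *)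
Lemma gbm_igamma_pdfE (t x : R) : 0 < t -> 0 < x ->
  gbm_pdf tmu sigma S0 t x * igamma_pdf k theta t =
  theta `^ k / (Num.sqrt (2 * pi) * sigma * Gamma k * S0)
  * (x / S0) `^ (tmu / sigma ^+ 2 - 1)
  * gig (k + 1 / 2) (ln (x / S0) ^+ 2 / sigma ^+ 2 + 2 * theta)
      (tmu ^+ 2 / sigma ^+ 2) t.
Proof.
move=> t0 x0; rewrite /gbm_pdf /igamma_pdf t0 x0/= /gig.
have xS0 : 0 < x / S0 by rewrite divr_gt0.
have tE : (1 / t) `^ (k + 1) * t `^ (- 2^-1) = t `^ (- (k + 1 / 2) - 1).
  rewrite div1r -[t^-1]powR_inv1 ?ltW// -powRrM -powRD; last first.
    by apply/implyP => _; rewrite gt_eqF.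
  by congr powR; field.
have xE : (x / S0) `^ (tmu / sigma ^+ 2 - 1) =
    expR (ln (x / S0) * (tmu / sigma ^+ 2)) * (S0 / x).
  rewrite powRD; last by apply/implyP => _; rewrite gt_eqF.
  by rewrite powR_inv1 ?ltW// invf_div expRM lnK.
rewrite xE -tE; set y := ln (x / S0).
have eE : expR (- ((y - tmu * t) ^+ 2 / (2 * sigma ^+ 2 * t))) * expR (- (theta / t)) =
  expR (y * (tmu / sigma ^+ 2)) *
  expR (- ((y ^+ 2 / sigma ^+ 2 + 2 * theta) / t + tmu ^+ 2 / sigma ^+ 2 * t) / 2).
  rewrite -!expRD; congr expR; field.
  by rewrite !gt_eqF.
transitivity (theta `^ k / (Num.sqrt (2 * pi) * sigma * Gamma k) / x *
  ((1 / t) `^ (k + 1) * t `^ (- 2^-1)) *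
  (expR (- ((y - tmu * t) ^+ 2 / (2 * sigma ^+ 2 * t))) * expR (- (theta / t)))).
  by rewrite !invfM; ring.
(* [Gamma k] is not known to be nonzero here, so its inverse is kept as an atom. *)
rewrite eE !invfM; move: (expR _) (expR _) (Gamma k)^-1 (Num.sqrt _)^-1 => e1 e2 G s.
by field; rewrite !gt_eqF.
Qed.

Lemma gbm_mixture_igamma (x : R) : 0 < x ->
  gbm_mixture tmu sigma S0 (igamma_pdf k theta) x =
  ((theta `^ k / (Num.sqrt (2 * pi) * sigma * Gamma k * S0)
  * (x / S0) `^ (tmu / sigma ^+ 2 - 1))%:E *
  \int[mu]_(t in `]0%R, +oo[)
    (gig (k + 1 / 2) (ln (x / S0) ^+ 2 / sigma ^+ 2 + 2 * theta)
      (tmu ^+ 2 / sigma ^+ 2) t)%:E)%E.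
Proof.
move=> x0; set c := _ * _ `^ _; set nu := k + 1 / 2.
set a := _ + 2 * theta; set b := tmu ^+ 2 / _.
have c0 : 0 <= c.
  rewrite /c mulr_ge0 ?powR_ge0// divr_ge0 ?powR_ge0// !mulr_ge0 ?sqrtr_ge0 ?(ltW S00)//.
  - exact: ltW.
  - apply: Rintegral_ge0 => t _; by rewrite mulr_ge0 ?powR_ge0 ?expR_ge0.
rewrite -ge0_integralZl//; last 2 first.
- apply/measurable_EFinP; apply: measurable_funTS; exact: measurable_gig.
- by move=> t _; rewrite lee_fin gig_ge0.
rewrite [RHS]integral_mkcond; apply: eq_integral => t _.
rewrite patchE mem_setE/= in_itv/= andbT; have [t0|t0] := ltP 0 t.
  by rewrite gbm_igamma_pdfE// EFinM.
by rewrite /gbm_pdf ltNge t0 mul0r.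
Qed.

End inverse_gamma_time.

Theorem mainTheorem4 (R : realType) (d : measure_display)
    (Omega : measurableType d) (P : probability Omega R)
    (B : R -> {RV P >-> R}) (T : {RV P >-> R})
    (mu sigma S0 k theta : R)
    (hB : standard_brownian_motion B)
    (hsigma : 0 < sigma) (hS0 : 0 < S0) (hk : 0 < k) (htheta : 0 < theta)
    (hTB : independent_of_process P T (fun t w => B t w))
    (hT : is_density (distribution P T) (igamma_pdf k theta)) :
  let tmu : R := mu - sigma ^+ 2 / 2 in
  let S : R -> Omega -> R :=
    fun t w => S0 * expR (tmu * t + sigma * B t w) in
  let S_T : Omega -> R := fun w => S (T w) w in
  (tmu != 0 ->
   has_pdf P S_T (fun x : R =>
     if 0 < x then
       Num.sqrt 2 * theta `^ k / (Num.sqrt pi * sigma * Gamma k * S0)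
       * (x / S0) `^ (tmu / sigma ^+ 2 - 1)
       * (ln (x / S0) ^+ 2 / sigma ^+ 2 + 2 * theta) `^ (- ((2 * k + 1) / 4))
       * (tmu ^+ 2 / sigma ^+ 2) `^ ((2 * k + 1) / 4)
       * besselK (k + 1 / 2)
           (Num.sqrt ((ln (x / S0) ^+ 2 / sigma ^+ 2 + 2 * theta)
                      * (tmu ^+ 2 / sigma ^+ 2)))
     else 0))
  /\
  (tmu = 0 ->
   has_pdf P S_T (fun x : R =>
     if 0 < x then
       2 `^ k * theta `^ k * Gamma (k + 1 / 2)
         / (Num.sqrt pi * sigma * Gamma k)
       * (1 / x)
       * ((ln (x / S0) / sigma) ^+ 2 + 2 * theta) `^ (- (k + 1 / 2))
     else 0)).
Proof.
move=> tmu S S_T.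
have ST : has_pdf P S_T (fine \o gbm_mixture tmu sigma S0 (igamma_pdf k theta)).
  apply: gbm_random_time => //.
  by move=> t; rewrite /igamma_pdf ltNge => ->.
have f_le0 x : x <= 0 -> fine (gbm_mixture tmu sigma S0 (igamma_pdf k theta) x) = 0.
  move=> x0; rewrite /gbm_mixture integral0_eq// => t _.
  by rewrite /gbm_pdf [0 < x]ltNge x0 andbF mul0r.
have a_gt0 x : 0 < ln (x / S0) ^+ 2 / sigma ^+ 2 + 2 * theta.
  by rewrite ltr_wpDl ?divr_ge0 ?sqr_ge0// mulr_gt0.
have sqrt2_gt0 : 0 < (Num.sqrt 2 : R) by rewrite sqrtr_gt0.
have half_sqrt2 : (Num.sqrt 2)^-1 * 2 = Num.sqrt 2 :> R.
  by rewrite -[X in _ * X](@sqr_sqrtr R 2)// expr2 mulKf// gt_eqF.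
split=> [tmu0|tmu0].
- have b0 : 0 < tmu ^+ 2 / sigma ^+ 2.
    by apply: divr_gt0; rewrite exprn_even_gt0//= gt_eqF.
  congr (has_pdf P S_T _): ST; apply/funext => x /=.
  case: ltP => [x0|]; last exact: f_le0.
  rewrite gbm_mixture_igamma// integral_gig_bessel// !fineZ /besselK /Rintegral.
  have -> : (k + 1 / 2) / 2 = (2 * k + 1) / 4 by field.
  set a := ln _ ^+ 2 / _ + _; set b := tmu ^+ 2 / _; set q := _ / 4.
  have -> : (b / a) `^ q = b `^ q * a `^ (- q).
    rewrite powRM ?invr_ge0 ?(ltW (a_gt0 x)) ?(ltW b0)//.
    by rewrite -[a^-1]powR_inv1 ?(ltW (a_gt0 x))// -powRrM mulN1r.
  rewrite sqrtrM// !invfM.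
  move: (fine _) (b `^ q) (a `^ _) (_ `^ (_ - 1)) (theta `^ k) => K B' A' X Th.
  rewrite -[in RHS]half_sqrt2.
  move: (Num.sqrt 2)^-1 (Num.sqrt pi)^-1 (Gamma k)^-1 => i2 ip iG.
  ring.
- congr (has_pdf P S_T _): ST; apply/funext => x /=.
  case: ltP => [x0|]; last exact: f_le0.
  rewrite gbm_mixture_igamma// tmu0 expr0n/= !mul0r integral_gig_gamma// !fineZ.
  rewrite [Gamma (k + 1 / 2)]/Gamma /Rintegral sub0r powR_inv1 ?divr_ge0 ?(ltW x0) ?(ltW hS0)// expr_div_n.
  set a := ln _ ^+ 2 / _ + _; set q := k + 1 / 2.
  have -> : (a / 2) `^ (- q) = a `^ (- q) * (2 `^ k * Num.sqrt 2).
    rewrite powRM ?invr_ge0 ?(ltW (a_gt0 x))//; congr (_ * _).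
    rewrite -[2^-1]powR_inv1// -powRrM mulN1r opprK powRD ?pnatr_eq0 ?implybT//.
    by rewrite div1r powR12_sqrt.
  rewrite sqrtrM// !invfM invrK.
  move: (fine _) (a `^ _) (2 `^ k) (theta `^ k) => Gq A' P2 Th.
  have s1 : (Num.sqrt 2)^-1 * Num.sqrt 2 = 1 :> R by rewrite mulVf ?gt_eqF.
  transitivity ((Num.sqrt 2)^-1 * Num.sqrt 2 * (P2 * Th * Gq *
     ((Num.sqrt pi)^-1 * sigma^-1 * (Gamma k)^-1) * x^-1 * A')).
    move: (Gamma k)^-1 (Num.sqrt pi)^-1 (Num.sqrt 2)^-1 => iG ip i2.
    by field; rewrite !gt_eqF.
  by rewrite s1; ring.
Qed.
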